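(* Let $m\ge 2$ be a fixed integer and let $q\in(0,1)$. For each $n$ let $\kappa=(k_1,\ldots,k_m)\in\mathcal{P}_n(m)$ be chosen with probability $P(\kappa)=c\cdot q^{k_1}$, where $c=c_{n,m}$ is the normalizing constant such that $\sum_{\kappa\in\mathcal{P}_n(m)}P(\kappa)=1$. Consider the subsequence of integers $n\equiv j_0\pmod m$, where $0\le j_0\le m-1$, and define $j=j_0$ if $1\le j_0\le m-1$ and $j=m$ if $j_0=0$. Then, as $n\to\infty$ along this subsequence, $k_1-\lceil\frac{n}{m}\rceil$ converges in distribution to a discrete random variable with probability mass function $$f(l)=\frac{q^{l}\cdot|\mathcal{P}_{ml+m-j}(m-1)|}{\sum_{s=0}^{\infty}q^{s}\cdot|\mathcal{P}_{ms+m-j}(m-1)|},\qquad l\in\{0,1,2,\ldots\}.$$ Furthermore, for each integer $l_1\ge 0$, the conditional distribution of $(k_2-\lceil\frac{n}{m}\rceil,\ldots,k_m-\lceil\frac{n}{m}\rceil)$ given $k_1=\lceil\frac{n}{m}\rceil+l_1$ is asymptotically (as $n\to\infty$ along this subsequence) the uniform distribution on the set $$\Big\{(l_2,\ldots,l_m)\in\mathbb{Z}^{m-1};\ l_1\ge l_2\ge\cdots\ge l_m\ \text{ and }\ l_1+\sum_{i=2}^m l_i=j-m\Big\}.$$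
   Context: For integers $n,m\ge 1$, $\mathcal{P}_n(m)$ denotes the set of partitions of $n$ with at most $m$ parts; its elements are written as $\kappa=(k_1,\ldots,k_m)$ with integers $k_1\ge k_2\ge\cdots\ge k_m\ge 0$ and $\sum_{i=1}^m k_i=n$ (shorter partitions are padded with zeros). $|A|$ denotes the cardinality of a set $A$, and by convention $|\mathcal{P}_0(k)|=1$ for every $k$. $\lceil x\rceil$ is the smallest integer $\ge x$. *)

(* Defs.v *)
From HB Require Import structures.
From mathcomp Require Import all_boot all_order all_algebra finmap.
From mathcomp Require Import all_classical all_reals all_analysis.

Set Implicit Arguments.
Unset Strict Implicit.
Unset Printing Implicit Defensive.
Import Order.TTheory GRing.Theory Num.Theory.
Import numFieldNormedType.Exports.

Local Open Scope classical_set_scope.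
Local Open Scope ring_scope.

(* The entries of a partition of n are at most n, so the ordinals below n.+1
   suffice to write (k_1, ..., k_m). *)
Definition kvec (n m : nat) : Type := m.-tuple 'I_n.+1.

HB.instance Definition _ (n m : nat) := Finite.on (kvec n m).
HB.instance Definition _ (n m : nat) :=
  isPointed.Build (kvec n m) [tuple of nseq m ord0].
HB.instance Definition _ (n m : nat) :=
  @isMeasurable.Build default_measure_display (kvec n m)
    discrete_measurable discrete_measurable0
    discrete_measurableC discrete_measurableU.

Definition partitions (n m : nat) : {set kvec n m} :=
  [set k : kvec n m | sorted geq (map val k) && (\sum_(i <- k) i == n)%N]%SET.

(* k_1 (the default value only matters for m = 0) *)
Definition part1 (n m : nat) (k : kvec n m) : nat := head ord0 k.

Definition ceil_div (n m : nat) : int := Num.ceil (n%:R / m%:R : rat).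

Section deviations.
Variables (R : realType) (n m : nat).

Definition dev1 (k : kvec n m) : R := (part1 k)%:R - (ceil_div n m)%:~R.

Let measurable_dev1 : measurable_fun [set: kvec n m] dev1.
Proof. by []. Qed.

HB.instance Definition _ :=
  isMeasurableFun.Build _ _ _ _ dev1 measurable_dev1.

(* (k_2 - ceil (n / m), ..., k_m - ceil (n / m)) *)
Definition dev_rest (k : kvec n m) : m.-1.-tuple int :=
  [tuple of [seq (val i)%:Z - ceil_div n m | i <- behead_tuple k]].

End deviations.

(* The X n may live on different probability spaces; G is the filter along
   which n varies. *)
Definition cvg_in_distribution (R : realType) (G : set_system nat)
    (d : nat -> measure_display) (T : forall n, measurableType (d n))
    (P : forall n, probability (T n) R) (X : forall n, {RV P n >-> R})
    (d' : measure_display) (T' : measurableType d') (Q : probability T' R)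
    (Y : {RV Q >-> R}) : Prop :=
  forall x : R, {for x, continuous (cdf Y)} ->
    cdf (X n) x @[n --> G] --> cdf Y x.

Definition has_pmf_on_nat (R : realType) (d : measure_display)
    (T : measurableType d) (Q : probability T R) (Y : {RV Q >-> R})
    (f : nat -> R) : Prop :=
  (forall l : nat, pmf Y l%:R = f l) /\
  Q (Y @^-1` range (fun l : nat => l%:R)) = 1%E.

Definition limit_weight (R : realType) (q : R) (m j l : nat) : R :=
  q ^+ l * #|partitions (m * l + m - j) m.-1|%:R.

Definition limit_pmf (R : realType) (q : R) (m j l : nat) : R :=
  limit_weight q m j l / limn (series (limit_weight q m j)).

Definition cond_prob (R : realType) (d : measure_display)
    (T : measurableType d) (P : probability T R) (A B : set T) : R :=
  fine (P (A `&` B)) / fine (P B).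

(* Uniform distribution on a nonempty finite set S, evaluated at A; both
   cardinalities are the junk value 0 when the set is infinite. *)
Definition uniform_on (R : realType) (T : choiceType) (S A : set T) : R :=
  #|` fset_set (A `&` S)|%:R / #|` fset_set S|%:R.

(* The tuple s stands for (l_2, ..., l_m). *)
Definition limit_support (m j l1 : nat) : set (m.-1.-tuple int) :=
  [set s | path (fun x y : int => y <= x) l1%:Z s /\
           l1%:Z + \sum_(x <- s) x = j%:Z - m%:Z].

Arguments limit_support m j l1 : clear implicits.

(* Main.v *)
(** Let a = ceil (n / m), so that n = m a - (m - j). Subtracting a from every
    part sends a partition of n with k_1 = a + l injectively to a decreasing
    tuple (l_2, ..., l_m) bounded by l with l + l_2 + ... + l_m = j - m, and
    this is onto once a is large, because the l_i are then bounded below by -a.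
    The complements l - l_i, in reverse order, form an arbitrary partition of
    m l + m - j into at most m - 1 parts. Hence the law of k_1 - a is
    proportional to q^l times a cardinality that is always at most
    |P_(m l + m - j)(m - 1)|, and equal to it for n large. These bounds grow
    polynomially in l, so dominated convergence applies to the normalizing
    sums. Given k_1, the weight q^(k_1) is constant, so the conditional law is
    eventually exactly the uniform one. *)
Require Import Defs.
From HB Require Import structures.
From mathcomp Require Import all_boot all_order all_algebra finmap.
From mathcomp Require Import all_classical all_reals all_analysis.
From mathcomp Require Import zify ring lra.
Import Order.TTheory GRing.Theory Num.Theory.
Import numFieldNormedType.Exports.

Local Open Scope classical_set_scope.
Local Open Scope ring_scope.

(** * Finite images, and partitions as plain sequences *)

Lemma card_fset_set_image (T : finType) (U : choiceType) (f : T -> U)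
    (B : {set T}) : {in B &, injective f} ->
  #|` fset_set (f @` [set` B])| = #|B|.
Proof.
move=> finj.
have finB : finite_set [set` B].
  exact: finite_finset.
rewrite fset_set_image// card_in_imfset/=; last first.
  by move=> x y; rewrite !in_fset_set// !inE => xB yB; apply: finj.
rewrite -(card_finset (fun x => x \in B)).
congr #|` _|; apply/fsetP => x.
by rewrite in_fset_set// !inE; apply/idP/idP => /=; rewrite ?inE.
Qed.

Lemma in_partitions (n d : nat) (k : kvec n d) :
  (k \in partitions n d) =
  sorted geq (map val k) && (sumn (map val k) == n).
Proof. by rewrite inE sumnE big_map. Qed.

(** No entry exceeds the sum [n], so [inord] alters nothing. The surjectivity arguments below build
    their preimages this way. *)
Lemma partition_of_seq (n d : nat) (t : seq nat) :
    size t = d -> sorted geq t -> sumn t = n ->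
  exists2 k : kvec n d, k \in partitions n d & map val k = t.
Proof.
move=> szt tsorted tsum.
have t_le x : x \in t -> (x < n.+1)%N.
  by move=> xt; rewrite ltnS -tsum sumnE (big_rem _ xt)/= leq_addr.
have szk : size (map inord t : seq 'I_n.+1) == d by rewrite size_map szt.
have kE : map val (Tuple szk) = t.
  rewrite /= -map_comp -[RHS]map_id; apply/eq_in_map => x xt /=.
  by rewrite inordK// t_le.
by exists (Tuple szk) => //; rewrite in_partitions kE tsorted tsum eqxx.
Qed.

Lemma kvec_val_inj (n d : nat) : injective (fun k : kvec n d => map val k).
Proof. by move=> k k' /(inj_map val_inj)/val_inj. Qed.

(** * Complements: the limiting support counted by partitions *)

Lemma sum_map_subz (l : int) (s : seq nat) :
  \sum_(x <- [seq l - i%:Z | i <- s]) x = l * (size s)%:Z - (sumn s)%:Z.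
Proof.
elim: s => [|x s IH] /=; first by rewrite big_nil mulr0.
by rewrite big_cons IH; lia.
Qed.

(* Reversed so that a decreasing partition yields decreasing l_i. *)
Definition complement (N d l : nat) (p : kvec N d) : d.-tuple int :=
  [tuple of [seq l%:Z - (val i)%:Z | i <- rev_tuple p]].
Arguments complement {N d} l p.

Lemma complementE (N d l : nat) (p : kvec N d) :
  complement l p = [seq l%:Z - i%:Z | i <- rev (map val p)] :> seq int.
Proof. by rewrite /= -map_rev -map_comp. Qed.

Lemma complement_inj (N d l : nat) :
  injective (complement l : kvec N d -> d.-tuple int).
Proof.
move=> p p' /(congr1 (@tval _ _)); rewrite !complementE.
move=> /inj_map eqp; apply/kvec_val_inj/(can_inj revK)/eqp => x y; lia.
Qed.

Lemma path_subz (l : int) (s : seq nat) :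
  path (fun x y : int => y <= x) l [seq l - i%:Z | i <- s] = sorted leq s.
Proof.
(* With [l] read as [l - 0], the upper bound [l] on the path becomes the lower bound 0 on [s], which
   always holds. *)
rewrite -[l in path _ l _]subr0
  -[l - 0]/((fun i : nat => l - i%:Z) 0%N) path_map.
rewrite -[RHS](@path_min_sorted _ _ 0%N); last exact/allP.
by apply: eq_path => x y /=; lia.
Qed.

Lemma path_le_head (l : int) (s : seq int) (x : int) :
  path (fun x y : int => y <= x) l s -> x \in s -> x <= l.
Proof.
rewrite path_sortedE; last by move=> a b c ab bc; exact: le_trans bc ab.
by move=> /andP[/allP/(_ x)] H _ /H.
Qed.

(** The differences [l - l_i] are natural numbers because the decreasing path starts at [l], and
    they sum to [(m - 1) l - (j - m - l) = m l + m - j]. *)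
Lemma complement_image (m j l : nat) : (0 < m)%N -> (j <= m)%N ->
  complement l @` [set` partitions (m * l + m - j) m.-1] = limit_support m j l.
Proof.
move=> m0 jm; apply/seteqP; split=> [_ [p /= + <-]|s [spath ssum]].
  rewrite in_partitions => /andP[psorted /eqP psum].
  rewrite /limit_support /= complementE; split.
    by rewrite path_subz rev_sorted.
  rewrite sum_map_subz sumn_rev psum size_rev size_map size_tuple.
  by nia.
pose t := rev [seq `|l%:Z - x|%N | x <- s].
have tE : [seq l%:Z - i%:Z | i <- rev t] = s.
  rewrite revK -map_comp -[RHS]map_id; apply/eq_in_map => x xs /=.
  by have := path_le_head _ _ _ spath xs; lia.
have tsorted : sorted geq t.
  by rewrite -(revK t) rev_sorted -(path_subz l) tE.
have szt : size t = m.-1 by rewrite size_rev size_map size_tuple.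
have tsum : sumn t = (m * l + m - j)%N.
  suff : (sumn t)%:Z = (m * l + m - j)%N by case.
  move: ssum; rewrite -tE.
  rewrite sum_map_subz sumn_rev size_rev szt.
  by nia.
have [p pP pE] := partition_of_seq _ _ _ szt tsorted tsum.
by exists p => //; apply: val_inj; apply: etrans (complementE _ _ _ _) _;
  rewrite pE.
Qed.

Lemma card_limit_support (m j l : nat) : (0 < m)%N -> (j <= m)%N ->
  #|` fset_set (limit_support m j l)| = #|partitions (m * l + m - j) m.-1|.
Proof.
move=> m0 jm; rewrite -complement_image// card_fset_set_image// => p p' _ _.
exact: complement_inj.
Qed.

Lemma finite_limit_support (m j l : nat) : (0 < m)%N -> (j <= m)%N ->
  finite_set (limit_support m j l).
Proof.
by move=> m0 jm; rewrite -complement_image//; apply: finite_image;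
  exact: finite_finset.
Qed.

(** * Partitions of [n] with a prescribed largest part *)

Section fibre.
Variables (m j n a : nat).
Hypotheses (m_gt0 : (0 < m)%N) (j_gt0 : (0 < j)%N) (jm : (j <= m)%N).
Hypothesis na : (n + (m - j) = m * a)%N.

(** [na] says that [n / m = a - (m - j) / m], and [1 <= j <= m] puts the subtracted fraction in
    [[0, 1)]. *)
Lemma ceil_divE : ceil_div n m = a.
Proof.
apply: ceil_def; rewrite ltr_pdivlMr ?ltr0n// ler_pdivrMr ?ltr0n//.
have : (n + (m - j))%:R = (m * a)%:R :> rat by rewrite na.
rewrite natrD natrM natrB// rmorphB /= -pmulrn.
have : (0 : rat) < j%:R by rewrite ltr0n.
have : j%:R <= m%:R :> rat by rewrite ler_nat.
by move=> jm0 j0 nE; apply/andP; split; lra.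
Qed.

(* With a = ceil (n / m), the partitions such that k_1 = a + l. *)
Definition fibre (l : nat) : {set kvec n m} :=
  [set k in partitions n m | part1 k == (a + l)%N].

Lemma in_fibre (l : nat) (k : kvec n m) :
  (k \in fibre l) = (k \in partitions n m) && (part1 k == (a + l)%N).
Proof. by rewrite !inE. Qed.

Lemma kvec_val_cons (k : kvec n m) :
  map val k = part1 k :: map val (behead k).
Proof. by case: m m_gt0 k => // d _; case/tupleP. Qed.

(** The largest part is at least the average [n / m], which exceeds [a - 1]. Hence the truncated
    subtraction [part1 k - a] is a true difference in what follows. *)
Lemma part1_ge (k : kvec n m) : k \in partitions n m -> (a <= part1 k)%N.
Proof.
rewrite in_partitions => /andP[ksorted /eqP ksum].
have k_le : all (geq (part1 k)) (map val k).
  move: ksorted; rewrite kvec_val_cons /= path_sortedE; last first.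
    by move=> b c e bc eb; exact: leq_trans eb bc.
  by rewrite leqnn => /andP[].
have : (sumn (map val k) <= size (map val k) * part1 k)%N.
  elim: (map val k) k_le => //= x s IH /andP[? /IH]; rewrite mulSn;
    exact: leq_add.
rewrite size_map size_tuple ksum; nia.
Qed.

Lemma part1_le (k : kvec n m) : (part1 k <= n)%N.
Proof. by rewrite -ltnS; exact: ltn_ord. Qed.

Lemma dev_restE (k : kvec n m) :
  dev_rest k = [seq i%:Z - a%:Z | i <- map val (behead k)] :> seq int.
Proof. by rewrite /= ceil_divE -map_comp. Qed.

(** [dev_rest] forgets only [k_1], which is fixed on a fibre. *)
Lemma dev_rest_inj (l : nat) : {in fibre l &, injective (@dev_rest n m)}.
Proof.
move=> k k'; rewrite !inE => /andP[_ /eqP k1] /andP[_ /eqP k1'].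
move=> /(congr1 (@tval _ _)); rewrite !dev_restE => /inj_map eqk.
apply: kvec_val_inj; rewrite !kvec_val_cons k1 k1'; congr cons.
by apply: eqk => x y; lia.
Qed.

Lemma path_subz_ge (x : nat) (s : seq nat) :
  path (fun x y : int => y <= x) (x%:Z - a%:Z) [seq i%:Z - a%:Z | i <- s] =
  path geq x s.
Proof.
rewrite -[x%:Z - _]/((fun i : nat => i%:Z - a%:Z) x) path_map.
by apply: eq_path => y z /=; lia.
Qed.

Lemma sum_map_subz_ge (s : seq nat) :
  \sum_(x <- [seq i%:Z - a%:Z | i <- s]) x = (sumn s)%:Z - a%:Z * (size s)%:Z.
Proof.
elim: s => [|x s IH] /=; first by rewrite big_nil mulr0.
by rewrite big_cons IH; lia.
Qed.

Lemma dev_rest_sub (l : nat) :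
  @dev_rest n m @` [set` fibre l] `<=` limit_support m j l.
Proof.
move=> _ [k /= + <-]; rewrite inE in_partitions kvec_val_cons.
move=> /andP[/andP[ksorted /eqP ksum] /eqP k1].
rewrite /limit_support /= dev_restE; split.
  rewrite (_ : l%:Z = (part1 k)%:Z - a%:Z) ?path_subz_ge//.
  by rewrite k1; lia.
rewrite sum_map_subz_ge size_map size_behead size_tuple.
by move: ksum; rewrite /= k1; nia.
Qed.

(** Valid for every [l], whatever the size of [a]: this is the domination for the passage to the
    limit. *)
Lemma card_fibre_le (l : nat) :
  (#|fibre l| <= #|partitions (m * l + m - j) m.-1|)%N.
Proof.
rewrite -(card_limit_support m j l)//
  -(card_fset_set_image _ _ _ _ (@dev_rest_inj l)).
apply: fsubset_leq_card; rewrite -fset_set_sub//.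
- exact: dev_rest_sub.
- by apply: finite_image; exact: finite_finset.
- exact: finite_limit_support.
Qed.

Lemma dev_rest_image (l : nat) : (m + m.-1 * l <= a)%N ->
  @dev_rest n m @` [set` fibre l] = limit_support m j l.
Proof.
move=> la; apply/seteqP; split=> [|s [spath ssum]]; first exact: dev_rest_sub.
(* The leading [l] and the [m - 2] entries other than [x] are all at most [l], so
   [x >= j - m - (m - 1) l], and the threshold on [a] makes this at least [- a]. *)
have s_ge (x : int) : x \in s -> - a%:Z <= x.
  move=> xs.
  have : \sum_(y <- rem x s) y <= l%:Z * (size (rem x s))%:Z.
    have : all (fun y => y <= l%:Z) (rem x s).
      by apply/allP => y /mem_rem; exact: path_le_head spath.
    elim: (rem x s) => [|y r IH] /=; first by rewrite big_nil mulr0.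
    move=> /andP[yl /IH rl]; rewrite big_cons /=
      -addn1 PoszD mulrDr mulr1 addrC.
    exact: lerD.
  have m1 : (0 < m.-1)%N by rewrite -(size_tuple s) -has_predT; apply/hasP;
    exists x.
  have szr : size (rem x s) = m.-2 by rewrite size_rem// size_tuple.
  have e : (m.-1 * l = m.-2 * l + l)%N by rewrite -{1}(prednK m1) mulSn addnC.
  move: ssum; rewrite (big_rem _ xs)/= szr -PoszM mulnC.
  by move: (\sum_(y <- _) y) la; rewrite e; clear -jm; lia.
(* By [s_ge] the absolute value is [a + x] itself. *)
pose t := [seq absz (a%:Z + x) | x <- s].
have tE : [seq i%:Z - a%:Z | i <- t] = s.
  rewrite -map_comp -[RHS]map_id; apply/eq_in_map => x xs /=.
  by have := s_ge x xs; lia.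
have szt : size t = m.-1 by rewrite size_map size_tuple.
have [|||k kP kE] := partition_of_seq n m ((a + l)%N :: t).
- by rewrite /= szt prednK.
- rewrite /= -path_subz_ge tE [_ - _](_ : _ = l%:Z)//.
  by rewrite PoszD addrC addKr.
- move: ssum; rewrite -tE sum_map_subz_ge szt /=; nia.
move: kE; rewrite kvec_val_cons => -[k1 kt].
exists k; first by rewrite /= inE kP k1 eqxx.
by apply: val_inj; apply: etrans (dev_restE _) _; rewrite kt.
Qed.

Lemma card_fibre (l : nat) : (m + m.-1 * l <= a)%N ->
  #|fibre l| = #|partitions (m * l + m - j) m.-1|.
Proof.
move=> la; rewrite -(card_limit_support m j l)// -dev_rest_image//.
by rewrite card_fset_set_image//; exact: dev_rest_inj.
Qed.

(** Restricting the bijection [dev_rest] to the tuples in [A] gives the numerator of the uniform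
    law. *)
Lemma card_fibre_dev_rest (l : nat) (A : set (m.-1.-tuple int)) :
    (m + m.-1 * l <= a)%N ->
  #|[set k in fibre l | `[< A (dev_rest k) >]]| =
  #|` fset_set (A `&` limit_support m j l)|.
Proof.
move=> la; rewrite -dev_rest_image// -(card_fset_set_image _ _ (@dev_rest n m)).
  congr #|` fset_set _|; apply/seteqP; split=> [_ [k /= + <-]|].
    by rewrite inE => /andP[kl /asboolP Ak]; split=> //; exists k.
  move=> s [As [k kl kE]]; exists k => //=.
  by rewrite inE; apply/andP; split=> //; apply/asboolP; rewrite kE.
apply: (sub_in2 _ (@dev_rest_inj l)) => k.
by move=> /setIdP[].
Qed.

End fibre.

(** * Summability of the limiting weights, and dominated convergence *)

Lemma expn_le_expR (R : realType) (d : nat) (x : R) : 0 <= x ->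
  x ^+ d <= d`!%:R * expR x.
Proof.
move=> x0; case: d => [|d]; first by rewrite expr0 fact0 mul1r -expR0 ler_expR.
rewrite -ler_pdivrMl ?ltr0n ?fact_gt0// mulrC.
by apply: le_trans (expR_ge1Dxn d x0); rewrite lerDr.
Qed.

Lemma is_cvg_series_poly_geometric (R : realType) (q : R) (d : nat) :
  0 < q < 1 -> cvgn (series (fun l : nat => q ^+ l * l.+1%:R ^+ d)).
Proof.
move=> /andP[q0 q1].
(* Thus [q = exp (- 2 r)]: one factor [exp (- r l)] absorbs the power of [l + 1], the other leaves a
   convergent geometric series. *)
pose r := - ln q / 2.
have r0 : 0 < r by rewrite divr_gt0// oppr_gt0 ln_lt0// q0 q1.
have qE : q = expR (- r) * expR (- r).
  by rewrite -expRD (_ : - r - r = ln q) ?lnK// /r; field.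
(* From [(l + 1) ^ d <= d! / r ^ d * exp (r (l + 1))]; the factor [expR r] accounts for the shift
   from [l] to [l + 1]. *)
pose K := d`!%:R / r ^+ d * expR r.
apply: (@series_le_cvg _ _ (geometric K (expR (- r)))).
- by move=> l; rewrite mulr_ge0// ?exprn_ge0// ltW.
- move=> l; rewrite /= mulr_ge0 ?exprn_ge0 ?expR_ge0//.
  by rewrite !mulr_ge0 ?expR_ge0 ?invr_ge0 ?exprn_ge0// ltW.
- move=> l; rewrite /= {1}qE exprMn -mulrA mulrC ler_wpM2r ?exprn_ge0
  ?expR_ge0//.
  have := expn_le_expR _ d (r * l.+1%:R) (mulr_ge0 (ltW r0) (ler0n _ _)).
  rewrite exprMn -ler_pdivlMl ?exprn_gt0// => H.
  apply: le_trans (ler_wpM2l _ H) _; first by rewrite exprn_ge0 ?expR_ge0.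
  rewrite /K -expRM_natr (_ : r * l.+1%:R = r * l%:R + r); last first.
    by rewrite -natr1 mulrDr mulr1.
  have E : expR (- r * l%:R) * expR (r * l%:R) = 1
    by rewrite -expRD mulNr addNr expR0.
  rewrite expRD [leLHS](_ : _ = (expR (- r * l%:R) * expR (r * l%:R)) * K).
    by rewrite E mul1r.
  rewrite /K; move: (expR (- r * _)) (expR (r * _)) (expR r) (d`!%:R) (r ^- d).
  by move=> t u v x y; ring.
- apply: (@is_cvg_geometric_series R K).
  by rewrite ger0_norm ?expR_ge0// expR_lt1 oppr_lt0.
Qed.

Lemma card_partitions_le (n d : nat) : (#|partitions n d| <= n.+1 ^ d)%N.
Proof.
by apply: leq_trans (max_card _) _; rewrite card_tuple card_ord.
Qed.

Lemma limit_weight_ge0 (R : realType) (q : R) (m j l : nat) :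
  0 <= q -> 0 <= limit_weight q m j l.
Proof. by move=> q0; rewrite mulr_ge0// exprn_ge0. Qed.

(** Since [m l + m - j + 1 <= (m + 1) (l + 1)], the crude count of partitions is bounded by a
    polynomial in [l] of degree [m - 1]. *)
Lemma is_cvg_series_limit_weight (R : realType) (q : R) (m j : nat) :
  0 < q < 1 -> cvgn (series (limit_weight q m j)).
Proof.
move=> q01; have q0 : 0 <= q by case/andP: q01 => /ltW.
apply: (@series_le_cvg _ _
  (m.+1%:R ^+ m.-1 *: (fun l : nat => q ^+ l * l.+1%:R ^+ m.-1))).
- by move=> l; exact: limit_weight_ge0.
- by move=> l; rewrite /= mulr_ge0 ?exprn_ge0// mulr_ge0 ?exprn_ge0.
- move=> l; rewrite /limit_weight /= fctE [_ *: _]mulrCA ler_wpM2l ?exprn_ge0//.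
  rewrite -!natrX -natrM ler_nat -expnMn.
  apply: leq_trans (card_partitions_le _ _) _.
  (* The exponent 0 is treated apart because [leq_exp2r] asks for a positive one. *)
  by case: m.-1 => // d; rewrite leq_exp2r//; nia.
- exact/is_cvg_seriesZ/is_cvg_series_poly_geometric.
Qed.

(** Tannery's theorem for terms that eventually equal their limits: for each [L], the sum is
    eventually squeezed between [series w L] and the full sum of [w]. *)
Lemma tannery (R : realType) (F : set_system nat) (FF : Filter F)
    (K : nat -> nat) (u : nat -> nat -> R) (w : nat -> R) :
    (forall n l, 0 <= u n l) -> (forall l, 0 <= w l) ->
    (\forall n \near F, forall l, u n l <= w l) ->
    (forall L, \forall n \near F,
      (L <= K n)%N /\ forall l, (l < L)%N -> u n l = w l) ->
    cvgn (series w) ->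
  \sum_(0 <= l < K n) u n l @[n --> F] --> limn (series w).
Proof.
move=> u0 w0 uw ueq cw.
apply/cvgrPdist_le => e e0.
have [L _ HL] := (cvgrPdist_le _ _).1 cw e e0.
have nds : nondecreasing_seq (series w) by apply: nondecreasing_series => i _ _.
near=> n.
have [LK uL] : (L <= K n)%N /\ forall l, (l < L)%N -> u n l = w l by near: n.
have lower : series w L <= \sum_(0 <= l < K n) u n l.
  rewrite (big_cat_nat _ (n := L))//= seriesEnat/=.
  rewrite (@eq_big_nat _ _ _ 0 L w (u n)).
    by rewrite lerDl sumr_ge0.
  by move=> l /andP[_ /uL].
have upper : \sum_(0 <= l < K n) u n l <= limn (series w).
  apply: le_trans (nondecreasing_cvgn_le nds cw (K n)).
  rewrite seriesEnat/=; apply: ler_sum => l _; move: l; near: n; exact: uw.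
have := HL L (leqnn _); rewrite /= !ger0_norm ?subr_ge0//; last first.
  exact: nondecreasing_cvgn_le.
by apply: le_trans; rewrite lerD2l lerN2.
Unshelve. all: by end_near. Qed.

(** * The probability law on the naturals with given summable weights *)

Definition natr_fun (R : realType) (l : nat) : R := l%:R.

Lemma measurable_natr_fun (R : realType) :
  measurable_fun [set: nat] (@natr_fun R).
Proof. by []. Qed.

HB.instance Definition _ (R : realType) :=
  isMeasurableFun.Build _ _ _ _ (@natr_fun R) (measurable_natr_fun R).

Lemma countable_range_natr_fun (R : realType) : countable (range (@natr_fun R)).
Proof. exact/card_image_le. Qed.

HB.instance Definition _ (R : realType) :=
  MeasurableFun_isDiscrete.Build _ _ _ _ (@natr_fun R)
    (countable_range_natr_fun R).

Section law_on_nat.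
Variables (R : realType) (w : nat -> R).
Hypotheses (w0 : forall l, 0 <= w l) (cw : cvgn (series w)).
Hypothesis w_gt0 : 0 < limn (series w).

Definition weighted_diracs : set nat -> \bar R :=
  mseries (fun l => mscale (NngNum (w0 l)) \d_l) 0.

HB.instance Definition _ := Measure.on weighted_diracs.

(** The Dirac mass at 0 is the default that [mnormalize] takes when the total mass is zero or
    infinite; [w_gt0] and [cw] exclude both cases. *)
Definition law_on_nat : set nat -> \bar R := mnormalize weighted_diracs \d_0%N.

HB.instance Definition _ := Probability.on law_on_nat.

Lemma weighted_diracE (l : nat) (A : set nat) :
  mscale (NngNum (w0 l)) \d_l A = (w l * (l \in A)%:R)%:E.
Proof. by rewrite -[LHS]/((w l)%:E * \d_l A)%E diracE. Qed.

Lemma weighted_diracsT : weighted_diracs setT = (limn (series w))%:E.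
Proof.
rewrite /weighted_diracs /mseries -EFin_lim//; apply/congr_lim/funext => n /=.
rewrite -sumEFin; apply: eq_bigr => l _ /=.
by rewrite weighted_diracE in_setT mulr1.
Qed.

(** Boundedness turns the series into a finite sum; this covers the singletons of the mass function
    and the half-lines of the cdf. *)
Lemma weighted_diracs_bounded (A : set nat) (M : nat) :
    (forall l, A l -> (l < M)%N) ->
  weighted_diracs A = (\sum_(0 <= l < M | `[< A l >]) w l)%:E.
Proof.
move=> AM; rewrite /weighted_diracs /mseries (nneseries_split 0 M)//.
rewrite add0n eseries0 ?adde0; last first.
  move=> l Ml _ /=; rewrite weighted_diracE memNset ?mulr0// => /AM.
  by rewrite ltnNge Ml.
rewrite -sumEFin [RHS]big_mkcond; apply: eq_bigr => l _ /=.
rewrite weighted_diracE; case: asboolP => Al.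
  by rewrite mem_set// mulr1.
by rewrite memNset// mulr0.
Qed.

Lemma law_on_nat_bounded (A : set nat) (M : nat) :
    (forall l, A l -> (l < M)%N) ->
  law_on_nat A = ((\sum_(0 <= l < M | `[< A l >]) w l) / limn (series w))%:E.
Proof.
move=> AM; rewrite /law_on_nat /mnormalize/= weighted_diracsT eqe gt_eqF//=.
by rewrite (weighted_diracs_bounded _ M)// -EFinM.
Qed.

Lemma has_pmf_natr_fun :
  has_pmf_on_nat (Q := law_on_nat) (@natr_fun R : {RV law_on_nat >-> R})
    (fun l => w l / limn (series w)).
Proof.
split=> [l|].
  rewrite /pmf [X in fine X](law_on_nat_bounded _ l.+1); last first.
    by move=> k /= /eqP; rewrite /natr_fun eqr_nat => /eqP ->.
  rewrite /= big_mkcond big_nat_recr//= big1_seq ?add0r.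
    by case: asboolP.
  move=> k /=; rewrite mem_index_iota/= => kl; case: asboolP => // /eqP.
  by rewrite /natr_fun eqr_nat ltn_eqF.
exact: (probability_range nat (@natr_fun R : {RV law_on_nat >-> R})).
Qed.

Lemma cdf_natr_fun (x : R) (M : nat) : x < M%:R ->
  cdf (@natr_fun R : {RV law_on_nat >-> R}) x =
  ((\sum_(0 <= l < M | l%:R <= x) w l) / limn (series w))%:E.
Proof.
move=> xM; rewrite [LHS](law_on_nat_bounded _ M).
  congr (_ / _)%:E; apply: eq_bigl => l.
  by apply/asboolP/idP; rewrite /= in_itv.
by move=> l /=; rewrite in_itv/= -(ltr_nat R) => /le_lt_trans; apply.
Qed.

End law_on_nat.

(** * The law of the largest part for fixed [n] *)

Lemma probability_finE (R : realType) (n m : nat) (P : probability (kvec n m) R)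
    (p : kvec n m -> R) (A : set (kvec n m)) :
  (forall k, P [set k] = (p k)%:E) -> P A = (\sum_(k | `[< A k >]) p k)%:E.
Proof.
move=> Pp.
have finA : finite_set A by exact: finite_finset.
rewrite -{1}[A]image_id -bigcup_imset1 measure_fin_bigcup//=; last first.
  by apply/trivIsetP => k k' _ _ /eqP kk'; apply/seteqP; split=> // x [-> ].
rewrite -sumEFin (bigfs _ (r := index_enum _)) ?index_enum_uniq//; last first.
  by move=> k _; rewrite mem_index_enum.
rewrite (_ : [set` _] = A).
  by apply: eq_fsbigr => k _.
by apply/seteqP; split => k /= /asboolP.
Qed.

Section largest_part.
Variables (R : realType) (m j n a : nat) (q c : R).
Hypotheses (m_gt0 : (0 < m)%N) (j_gt0 : (0 < j)%N) (jm : (j <= m)%N).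
Hypothesis na : (n + (m - j) = m * a)%N.
Hypothesis q_gt0 : 0 < q.
Variable P : probability (kvec n m) R.
Hypothesis sum_mass : \sum_(k in partitions n m) c * q ^+ part1 k = 1.
Hypothesis massE : forall k : kvec n m,
  P [set k] = (if k \in partitions n m then c * q ^+ part1 k else 0)%:E.

Definition fibre_weight (l : nat) : R := q ^+ l * #|fibre m n a l|%:R.

Lemma fibre_weight_ge0 (l : nat) : 0 <= fibre_weight l.
Proof. by rewrite mulr_ge0// exprn_ge0// ltW. Qed.

Lemma fibre_weight_le (l : nat) : fibre_weight l <= limit_weight q m j l.
Proof.
rewrite ler_wpM2l ?(exprn_ge0 _ (ltW q_gt0))// ler_nat.
exact: (card_fibre_le m j n a).
Qed.

Lemma fibre_weightE (l : nat) : (m + m.-1 * l <= a)%N ->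
  fibre_weight l = limit_weight q m j l.
Proof. by move=> la; rewrite /fibre_weight (card_fibre m j n a). Qed.

(** Partitions are grouped by [l = k_1 - a], and [q ^ (a + l)] splits so that [c * q ^ a] factors
    out. As [k_1 <= n], the indices below [n + 1] reach every nonempty fibre. *)
Lemma sum_fibres (Q : pred nat) :
  \sum_(k in partitions n m | Q (part1 k - a)%N) c * q ^+ part1 k =
  c * q ^+ a * \sum_(0 <= l < n.+1 | Q l) fibre_weight l.
Proof.
have dev_lt (k : kvec n m) : (part1 k - a < n.+1)%N.
  by rewrite ltnS (leq_trans (leq_subr _ _))// part1_le.
rewrite (partition_big
  (fun k => inord (part1 k - a)%N : 'I_n.+1) (fun l => Q l)).
  rewrite big_mkord mulr_sumr; apply: eq_bigr => l Ql.
  rewrite (eq_bigl (fun k => k \in fibre m n a l)); last first.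
    move=> k; rewrite in_fibre; have [kP/=|//] := boolP (k \in partitions n m).
    have ak := part1_ge m j n a m_gt0 j_gt0 jm na k kP.
    rewrite -val_eqE/= inordK// -[part1 k in RHS](subnKC ak) eqn_add2l.
    by case: eqP => [->|]; rewrite ?andbF// Ql.
  rewrite (eq_bigr (fun=> c * q ^+ a * q ^+ l)); last first.
    by move=> k; rewrite in_fibre => /andP[_ /eqP ->]; rewrite exprD mulrA.
  by rewrite sumr_const -mulr_natr -!mulrA.
by move=> k /andP[_ Qk]; rewrite inordK.
Qed.

(** Identifies the factor [c * q ^ a] as the inverse of the sum of the fibre weights; in particular
    it is nonzero. *)
Lemma normalizationE :
  c * q ^+ a * (\sum_(0 <= l < n.+1) fibre_weight l) = 1.
Proof.
rewrite -sum_mass -(sum_fibres xpredT).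
by apply: eq_bigl => k; rewrite andbT.
Qed.

Lemma probE (A : set (kvec n m)) :
  P A = (\sum_(k in partitions n m | `[< A k >]) c * q ^+ part1 k)%:E.
Proof.
rewrite (probability_finE _ _ _ _ _ _ massE) -big_mkcondr.
by congr (_%:E); apply: eq_bigl => k; rewrite andbC.
Qed.

Lemma cdf_dev1 (x : R) :
  cdf (@dev1 R n m : {RV P >-> R}) x =
  ((\sum_(0 <= l < n.+1 | l%:R <= x) fibre_weight l) /
   (\sum_(0 <= l < n.+1) fibre_weight l))%:E.
Proof.
rewrite [LHS]probE; congr _%:E.
have S0 : \sum_(0 <= l < n.+1) fibre_weight l != 0.
  by apply/eqP => S0; move/eqP: normalizationE;
    rewrite S0 mulr0 eq_sym oner_eq0.
have -> : (\sum_(0 <= l < n.+1) fibre_weight l)^-1 = c * q ^+ a.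
  by apply: (mulIf S0); rewrite mulVf// normalizationE.
rewrite mulrC; have /= <- := sum_fibres (fun l => l%:R <= x).
apply: eq_bigl => k; have [kP/=|//] := boolP (k \in partitions n m).
have ak := part1_ge m j n a m_gt0 j_gt0 jm na k kP.
rewrite natrB//; apply/asboolP/idP;
  rewrite /= in_itv/= /dev1 (ceil_divE m j n a)//.
Qed.

(** All partitions of a fibre have the same mass, so probabilities there reduce to counting. *)
Lemma prob_part1 (l : nat) (A : set (kvec n m)) :
  P (A `&` [set k | (part1 k)%:Z = ceil_div n m + l%:Z]) =
  (c * q ^+ (a + l) * #|[set k in fibre m n a l | `[< A k >]]|%:R)%:E.
Proof.
rewrite probE (ceil_divE m j n a)//; congr _%:E.
rewrite (eq_bigl (fun k => k \in [set k in fibre m n a l | `[< A k >]]%SET)).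
  rewrite (eq_bigr (fun=> c * q ^+ (a + l))) ?sumr_const ?mulr_natr//.
  by move=> k /setIdP[]; rewrite in_fibre => /andP[_ /eqP ->].
move=> k; rewrite [RHS]finset.in_set in_fibre -andbA; congr (_ && _).
apply/asboolP/andP => [[Ak /= k1]|[/eqP k1 /asboolP Ak]].
  by split; [apply/eqP; case: k1|apply/asboolP].
by split=> //=; rewrite k1.
Qed.

Lemma cond_probE (l : nat) (A : set (m.-1.-tuple int)) :
    (m + m.-1 * l <= a)%N ->
  cond_prob P [set k | A (dev_rest k)]
    [set k | (part1 k)%:Z = ceil_div n m + l%:Z] =
  uniform_on R (limit_support m j l) A.
Proof.
move=> la; rewrite /cond_prob /uniform_on.
(* Written as an intersection with [setT], the conditioning event falls under [prob_part1] too. *)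
rewrite -[in X in _ / fine (P X)](setTI [set k | _ = _]) !prob_part1/=.
rewrite (card_fibre_dev_rest m j n a)// (card_limit_support m j l)//.
rewrite -(card_fibre m j n a)//.
rewrite (_ : [set k in fibre m n a l | `[< setT k >]]%SET = fibre m n a l);
  last first.
  by apply/setP => k; rewrite finset.in_set asboolT// andbT.
rewrite -mulf_div divff ?mul1r//.
have : c * q ^+ a != 0.
  by apply/eqP => cq0; move/eqP: normalizationE;
    rewrite cq0 mul0r eq_sym oner_eq0.
by move=> ?; rewrite exprD mulrA mulf_neq0// expf_neq0// gt_eqF.
Qed.

End largest_part.

(** * Passage to the limit along the residue class *)

Theorem corollary1 (R : realType) (m : nat) (hm : (2 <= m)%N)
    (q : R) (hq : 0 < q < 1)
    (c : nat -> R)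
    (hc : forall n : nat, \sum_(k in partitions n m) c n * q ^+ part1 k = 1)
    (P : forall n : nat, probability (kvec n m) R)
    (hP : forall (n : nat) (k : kvec n m),
        P n [set k] =
          (if k \in partitions n m then c n * q ^+ part1 k else 0)%:E)
    (j0 j : nat) (hj0 : (j0 <= m - 1)%N)
    (hj : j = if (1 <= j0)%N then j0 else m) :
  let G := within [set n : nat | n = j0 %[mod m]] \oo in
  (exists (d : measure_display) (T : measurableType d) (Q : probability T R)
      (Y : {dRV Q >-> R}),
      has_pmf_on_nat (Q := Q) Y (limit_pmf q m j) /\
      cvg_in_distribution G (P := P) (fun n => @dev1 R n m) (Q := Q) Y) /\
  (forall (l1 : nat) (A : set (m.-1.-tuple int)),
      cond_prob (P n) [set k | A (dev_rest k)]
          [set k | (part1 k)%:Z = ceil_div n m + l1%:Z]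
        @[n --> G] --> uniform_on R (limit_support m j l1) A).
Proof.
move=> G.
have m0 : (0 < m)%N by exact: ltnW.
have [q0 q1] := andP hq.
have [j_gt0 jm] : (0 < j)%N /\ (j <= m)%N by rewrite hj; case: ifP; lia.
(* On the residue class the division is exact, because [j] is congruent to [j0] modulo [m]; this is
   [ceil (n / m)] there. *)
pose a n := ((n + (m - j)) %/ m)%N.
(* Reduces eventual statements along [G] to those with [na] and [a n] large; [n >= N * m] ensures
   [a n >= N]. *)
have nearG (N : nat) (p : nat -> Prop) :
    (forall n, (n + (m - j) = m * a n)%N -> (N <= a n)%N -> p n) ->
  \forall n \near G, p n.
  move=> Np; exists (N * m)%N => // n /= Nn nj0; apply: Np.
    rewrite mulnC divnK// /dvdn; apply/eqP.
    rewrite -modnDml nj0 modnDml hj; case: ifP => j01.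
      by rewrite subnKC ?modnn//; lia.
    by rewrite subnn addn0 (_ : j0 = 0%N) ?mod0n//; lia.
  by rewrite leq_divRL// (leq_trans Nn)// leq_addr.
have near_weight (L : nat) : \forall n \near G,
    (L <= n.+1)%N /\
    forall l, (l < L)%N -> fibre_weight R m n (a n) q l = limit_weight q m j l.
  (* One threshold serves all [l < L]. It also exceeds [L] because [2 <= m], and [a n <= n + 1]. *)
  apply: (nearG (m + m.-1 * L)%N) => n na Na; split.
    have : (a n <= n.+1)%N by move: na; nia.
    apply: leq_trans; apply: leq_trans Na; nia.
  move=> l lL; apply: fibre_weightE => //.
  by apply: leq_trans Na; rewrite leq_add2l leq_mul2l (ltnW lL) orbT.
have w0 l : 0 <= limit_weight q m j l by apply: limit_weight_ge0; exact: ltW.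
have cw := is_cvg_series_limit_weight _ _ m j hq.
have sum_cvg : \sum_(0 <= l < n.+1) fibre_weight R m n (a n) q l @[n --> G] -->
    limn (series (limit_weight q m j)).
  apply: tannery => //.
    by move=> n l; exact: fibre_weight_ge0.
  by apply: (nearG 0%N) => n na _ l; exact: fibre_weight_le.
have W_gt0 : 0 < limn (series (limit_weight q m j)).
  have nds : nondecreasing_seq (series (limit_weight q m j)).
    by apply: nondecreasing_series => i _ _.
  (* The term [l = 0] already counts the partition [(m - j, 0, ..., 0)], which has room among
     [m - 1 >= 1] parts. *)
  apply: lt_le_trans (nondecreasing_cvgn_le nds cw 1%N).
  rewrite seriesEnat/= big_nat1 /limit_weight expr0 mul1r ltr0n card_gt0.
  have [|||k kP _] := partition_of_seq (m * 0 + m - j) m.-1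
      ((m * 0 + m - j)%N :: nseq m.-2 0%N).
  - by rewrite /= size_nseq; lia.
  - by rewrite /=; elim: m.-2 (_ - j)%N => //= d IH x; exact: IH.
  - by rewrite /= sumn_nseq mul0n addn0.
  by apply/set0Pn; exists k.
split; last first.
  move=> l1 A; apply: cvg_near_cst; apply: (nearG (m + m.-1 * l1)%N) => n na la.
  exact: (cond_probE R m j n (a n) q (c n)).
exists _, nat, (law_on_nat R (limit_weight q m j) w0), (@natr_fun R).
split; first exact: has_pmf_natr_fun.
move=> x _.
have [M xM] : exists M : nat, x < M%:R.
  exists (Num.truncn `|x|).+1.
  by rewrite (le_lt_trans (ler_norm x))// truncnS_gt.
rewrite (cdf_natr_fun _ _ w0 cw W_gt0 x M xM).
(* As [l <= x] forces [l < M], the numerator of the cdf is eventually the fixed limiting one, and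
   only the denominator varies with [n]; it converges by [sum_cvg]. *)
apply: cvg_trans.
  apply: (near_eq_cvg (f := fun n =>
    ((\sum_(0 <= l < M | l%:R <= x) limit_weight q m j l) /
    \sum_(0 <= l < n.+1) fibre_weight R m n (a n) q l)%:E)).
  have natG : \forall n \near G, (n + (m - j) = m * a n)%N
    by apply: (nearG 0%N).
  near=> n.
  rewrite (cdf_dev1 R m j n (a n) q (c n))//; last by near: n.
  have [Mn eqw] : (M <= n.+1)%N /\
    forall l, (l < M)%N -> fibre_weight R m n (a n) q l = limit_weight q m j l.
    by near: n; exact: near_weight.
  congr ((_ / _)%:E); rewrite [RHS](big_cat_nat _ (n := M))//=.
  rewrite [X in _ = _ + X]big1_seq ?addr0.
    by rewrite [LHS]big_mkcond [RHS]big_mkcond;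
      apply: eq_big_nat => l /andP[_ lM]; rewrite eqw.
  move=> l /andP[lx]; rewrite mem_index_iota => /andP[Ml _].
  have Mx : M%:R <= x by rewrite (le_trans _ lx)// ler_nat.
  by have := lt_le_trans xM Mx; rewrite ltxx.
apply: cvg_EFin; first exact: nearW.
apply: cvgM; first exact: cvg_cst.
by apply: cvgV; rewrite ?gt_eqF.
Unshelve. all: by end_near. Qed.
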